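(* On the category of sets, let $\mathrm{supp}_X\colon\mathbf{D}X\to\mathbf{R}X$ be $\mathrm{supp}(\lambda_1|x_1\rangle+\dots+\lambda_n|x_n\rangle)=\{x_1,\dots,x_n\}$. Support is a sesquilaw morphism, with $\mathbf{F}=\mathrm{Id}$ the identity functor, from the normalization sesquilaw $(\mathbf{M},\mathbf{D},(-)^{\bullet},(-)^{\circ})$ to the post-selection sesquilaw $(\mathbf{M},\mathbf{R},\mathsf{i},\mathsf{p})$; that is, the pair $\alpha=\mathrm{id}\colon\mathbf{M}\to\mathbf{M}$ and $\beta=\mathrm{supp}\colon\mathbf{D}\to\mathbf{R}$ is a sesquilaw morphism.
   Context: Distribution monad: $\mathbf{D}X$ is the set of finite formal sums $\sum_i\lambda_i|x_i\rangle$ with $x_i\in X$, $\lambda_i>0$, $\sum_i\lambda_i=1$; unit $\eta^{\mathbf D}(x)=|x\rangle$; multiplication $\mu^{\mathbf D}(\sum_i\lambda_i|\sum_j\mu_{ij}|x_{ij}\rangle\rangle)=\sum_{i,j}\lambda_i\mu_{ij}|x_{ij}\rangle$. Affine powerset monad: $\mathbf{R}X$ is the set of non-empty finite subsets of $X$, with multiplication union and unit $x\mapsto\{x\}$. Maybe monad: $\mathbf{M}X=X+\{\bot\}$, with the usual structure. Elements of $\mathbf{D}\mathbf{M}X$ are identified with subdistributions $\sum_i\lambda_i|x_i\rangle$ over $X$, $\lambda_i>0$, $\sum_i\lambda_i\le1$ (missing mass at $\bot$); $0$ stands for $|\bot\rangle\in\mathbf{D}\mathbf{M}X$ and for $\bot\in\mathbf{M}\mathbf{D}X$.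 Normalization $(-)^\circ\colon\mathbf{D}\mathbf{M}X\to\mathbf{M}\mathbf{D}X$: $(\sum_i\lambda_i|x_i\rangle)^\circ=\sum_i\frac{\lambda_i}{\sum_k\lambda_k}|x_i\rangle$ if $\sum_k\lambda_k\ne0$, and $(0)^\circ=0$. Inclusion $(-)^\bullet\colon\mathbf{M}\mathbf{D}X\to\mathbf{D}\mathbf{M}X$: $(\bot)^\bullet=0$, $(\sum_i\lambda_i|x_i\rangle)^\bullet=\sum_i\lambda_i|x_i\rangle$. Post-selection $\mathsf{p}\colon\mathbf{R}\mathbf{M}X\to\mathbf{M}\mathbf{R}X$: $\mathsf{p}(A\cup\{\bot\})=\mathsf{p}(A)=A$ for $A\in\mathbf{R}X$, $\mathsf{p}(\{\bot\})=\bot$. Inclusion $\mathsf{i}\colon\mathbf{M}\mathbf{R}X\to\mathbf{R}\mathbf{M}X$: $\mathsf{i}(\bot)=\{\bot\}$, $\mathsf{i}(A)=A$. A monad morphism from a monad $S$ on $\mathbb{A}_1$ to a monad $T$ on $\mathbb{A}_2$ over a functor $F\colon\mathbb{A}_1\to\mathbb{A}_2$ is a natural transformation $\alpha\colon FS\to TF$ with $\alpha\circ F\mu^S=\mu^TF\circ T\alpha\circ\alpha S$ and $\alpha\circ F\eta^S=\eta^TF$. A sesquilaw morphism from $(S_1,T_1,m_1,n_1)$ to $(S_2,T_2,m_2,n_2)$ (with $m_i\colon S_iT_i\to T_iS_i$ and $n_i\colon T_iS_i\to S_iT_i$) over $F$ is a pair of monad morphisms $\alpha\colon FS_1\to S_2F$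 and $\beta\colon FT_1\to T_2F$ such that (1) $T_2\alpha\circ\beta S_1\circ Fm_1=m_2F\circ S_2\beta\circ\alpha T_1$ as maps $FS_1T_1\to T_2S_2F$; (2) $S_2\beta\circ\alpha T_1\circ Fn_1=n_2F\circ T_2\alpha\circ\beta S_1$ as maps $FT_1S_1\to S_2T_2F$. *)

(* Defs.v *)
From mathcomp Require Import all_boot all_order all_algebra finmap.
From mathcomp Require Import boolp classical_sets functions cardinality fsbigop.
From mathcomp Require Import reals.

Set Implicit Arguments.
Unset Strict Implicit.
Unset Printing Implicit Defensive.

Import Order.TTheory GRing.Theory Num.Theory.

Local Open Scope classical_set_scope.
Local Open Scope ring_scope.

#[local] Obligation Tactic := idtac.

Declare Scope cat_scope.
Delimit Scope cat_scope with cat.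
Local Open Scope cat_scope.

Record category := Category {
  ob :> Type;
  hom : ob -> ob -> Type;
  idm : forall X, hom X X;
  comp : forall X Y Z, hom Y Z -> hom X Y -> hom X Z;
  comp_idl : forall X Y (f : hom X Y), comp (idm Y) f = f;
  comp_idr : forall X Y (f : hom X Y), comp f (idm X) = f;
  compA : forall X Y Z W (h : hom Z W) (g : hom Y Z) (f : hom X Y),
    comp h (comp g f) = comp (comp h g) f }.

Notation "g ∘ f" := (comp g f) (at level 40, left associativity) : cat_scope.

Record functor (A B : category) := Functor {
  fobj :> A -> B;
  fmap : forall X Y, hom X Y -> hom (fobj X) (fobj Y);
  fmap_id : forall X, fmap (idm X) = idm (fobj X);
  fmap_comp : forall X Y Z (g : hom Y Z) (f : hom X Y),
    fmap (g ∘ f) = fmap g ∘ fmap f }.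
Arguments fmap {A B} F {X Y} f : rename.

Definition id_functor (A : category) : functor A A :=
  @Functor A A (fun X => X) (fun _ _ f => f)
    (fun _ => erefl) (fun _ _ _ _ _ => erefl).

Definition comp_functor (A B C : category) (G : functor B C) (F : functor A B)
  : functor A C.
Proof.
refine (@Functor A C (fun X => G (F X)) (fun _ _ f => fmap G (fmap F f)) _ _).
- by move=> X; rewrite !fmap_id.
- by move=> X Y Z g f; rewrite !fmap_comp.
Defined.

Definition natural (A B : category) (F G : functor A B)
    (alpha : forall X, hom (F X) (G X)) : Prop :=
  forall X Y (f : hom X Y), alpha Y ∘ fmap F f = fmap G f ∘ alpha X.

Record monad (A : category) := Monad {
  mfun :> functor A A;
  munit : forall X, hom X (mfun X);
  mmult : forall X, hom (mfun (mfun X)) (mfun X);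
  munit_natural : natural (F := id_functor A) (G := mfun) munit;
  mmult_natural : natural (F := comp_functor mfun mfun) (G := mfun) mmult;
  mmult_unitl : forall X, mmult X ∘ munit (mfun X) = idm (mfun X);
  mmult_unitr : forall X, mmult X ∘ fmap mfun (munit X) = idm (mfun X);
  mmultA : forall X,
    mmult X ∘ fmap mfun (mmult X) = mmult X ∘ mmult (mfun X) }.
Arguments munit {A} T X : rename.
Arguments mmult {A} T X : rename.

Definition is_monad_morphism (A1 A2 : category) (S : monad A1) (T : monad A2)
    (F : functor A1 A2) (alpha : forall X, hom (F (S X)) (T (F X))) : Prop :=
  [/\ natural (F := comp_functor F S) (G := comp_functor T F) alpha,
      forall X, alpha X ∘ fmap F (mmult S X)
                = mmult T (F X) ∘ fmap T (alpha X) ∘ alpha (S X)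
    & forall X, alpha X ∘ fmap F (munit S X) = munit T (F X)].

(* The quadruple (S, T, m, n), on which the notion of sesquilaw morphism
   depends; no compatibility between m, n and the monad structures is
   recorded here. *)
Record sesquilaw_data (A : category) := SesquilawData {
  sl_S : monad A;
  sl_T : monad A;
  sl_m : forall X, hom (sl_S (sl_T X)) (sl_T (sl_S X));
  sl_n : forall X, hom (sl_T (sl_S X)) (sl_S (sl_T X));
  sl_m_natural :
    natural (F := comp_functor sl_S sl_T) (G := comp_functor sl_T sl_S) sl_m;
  sl_n_natural :
    natural (F := comp_functor sl_T sl_S) (G := comp_functor sl_S sl_T) sl_n }.

Definition is_sesquilaw_morphism (A1 A2 : category)
    (L1 : sesquilaw_data A1) (L2 : sesquilaw_data A2) (F : functor A1 A2)
    (alpha : forall X, hom (F (sl_S L1 X)) (sl_S L2 (F X)))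
    (beta : forall X, hom (F (sl_T L1 X)) (sl_T L2 (F X))) : Prop :=
  [/\ is_monad_morphism alpha,
      is_monad_morphism beta,
      forall X, fmap (sl_T L2) (alpha X) ∘ beta (sl_S L1 X) ∘ fmap F (sl_m L1 X)
        = sl_m L2 (F X) ∘ fmap (sl_S L2) (beta X) ∘ alpha (sl_T L1 X)
    & forall X, fmap (sl_S L2) (beta X) ∘ alpha (sl_T L1 X) ∘ fmap F (sl_n L1 X)
        = sl_n L2 (F X) ∘ fmap (sl_T L2) (alpha X) ∘ beta (sl_S L1 X)].

Definition sets : category :=
  @Category Type (fun X Y => X -> Y) (fun X x => x)
    (fun X Y Z g f x => g (f x))
    (fun _ _ _ => erefl) (fun _ _ _ => erefl) (fun _ _ _ _ _ _ _ => erefl).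

Definition maybe_functor : functor sets sets.
Proof.
refine (@Functor sets sets option (fun X Y (f : X -> Y) => omap f) _ _).
- by move=> X; apply: funext => -[].
- by move=> X Y Z g f; apply: funext => -[].
Defined.

Definition maybe_monad : monad sets.
Proof.
refine (@Monad sets maybe_functor (fun X => @Some X)
  (fun X (o : option (option X)) => if o is Some o' then o' else None)
  _ _ _ _ _).
- by [].
- by move=> X Y f; apply: funext => -[].
- by [].
- by move=> X; apply: funext => -[].
- by move=> X; apply: funext => -[].
Defined.

Section Powerset.
Context {X : Type}.

Record fpset := FPset {
  fpset_set :> set X;
  fpset_finite : finite_set fpset_set;
  fpset_neq0 : fpset_set !=set0 }.

Lemma fpset_ext (A B : fpset) : (A : set X) = B -> A = B.
Proof.
case: A => A fA nA; case: B => B fB nB /= AB; subst B.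
by rewrite (Prop_irrelevance fA fB) (Prop_irrelevance nA nB).
Qed.

Definition fpset1 (x : X) : fpset := FPset (finite_set1 x) (ex_intro _ x erefl).
End Powerset.
Arguments fpset : clear implicits.

Section PowersetOps.
Context {X Y : Type}.

Program Definition fpset_map (f : X -> Y) (A : fpset X) : fpset Y :=
  @FPset Y (f @` A) _ _.
Next Obligation. by move=> f A; apply/finite_image/fpset_finite. Qed.
Next Obligation. by move=> f A; have [x Ax] := fpset_neq0 A; exists (f x), x. Qed.

Program Definition fpset_join (AA : fpset (fpset X)) : fpset X :=
  @FPset X (\bigcup_(A in (AA : set (fpset X))) A) _ _.
Next Obligation.
by move=> AA; apply: bigcup_finite (fpset_finite AA) _ => A _; apply: fpset_finite.
Qed.
Next Obligation.
move=> AA; have [A AAA] := fpset_neq0 AA; have [x Ax] := fpset_neq0 A.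
by exists x, A.
Qed.
End PowersetOps.

Definition powerset_functor : functor sets sets.
Proof.
refine (@Functor sets sets fpset (fun X Y (f : X -> Y) => fpset_map f) _ _).
- by move=> X; apply: funext => A; apply: fpset_ext; rewrite /= image_id.
- by move=> X Y Z g f; apply: funext => A; apply: fpset_ext; rewrite /= image_comp.
Defined.

Definition powerset_monad : monad sets.
Proof.
refine (@Monad sets powerset_functor (fun X => @fpset1 X)
  (fun X => @fpset_join X) _ _ _ _ _).
- by move=> X Y f; apply: funext => x; apply: fpset_ext; rewrite /= image_set1.
- move=> X Y f; apply: funext => A; apply: fpset_ext; apply/seteqP; split => /=.
  + by move=> y [_ [B AB <-] [x Bx <-]]; exists x => //; exists B.
  + by move=> y [x [B AB Bx] <-]; exists (fpset_map f B); [exists B|exists x].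
- move=> X; apply: funext => A; apply: fpset_ext; apply/seteqP; split => /=.
  + by move=> x [_ -> Ax].
  + by move=> x Ax; exists A.
- move=> X; apply: funext => A; apply: fpset_ext; apply/seteqP; split => /=.
  + by move=> x [_ [y Ay <-] ->].
  + by move=> x Ax; exists (fpset1 x) => //; exists x.
- move=> X; apply: funext => A; apply: fpset_ext; apply/seteqP; split => /=.
  + by move=> x [_ [B AB <-] [C BC Cx]]; exists C => //; exists B.
  + by move=> x [C [B AB BC] Cx]; exists (fpset_join B); [exists B|exists C].
Defined.

Section PostSelection.
Context {X : Type}.

Lemma post_finite (B : fpset (option X)) : finite_set (Some @^-1` B).
Proof.
apply: finite_preimage; last exact: fpset_finite.
by move=> x y _ _ [].
Qed.

(* Sends both A and A ∪ {None}, for A a non-empty set of elements of X, to A,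
   and {None} to None. *)
Definition post_select (B : fpset (option X)) : option (fpset X) :=
  match pselect (Some @^-1` B !=set0) with
  | left h => Some (FPset (post_finite B) h)
  | right _ => None
  end.

Definition maybe_set_incl (A : option (fpset X)) : fpset (option X) :=
  if A is Some A' then fpset_map Some A' else fpset1 None.
End PostSelection.

Lemma post_selectP X (B : fpset (option X)) (A : fpset X) :
  (A : set X) = Some @^-1` B -> post_select B = Some A.
Proof.
move=> AB; rewrite /post_select; case: pselect => [h|h].
  by congr Some; apply: fpset_ext; rewrite AB.
by case: h; rewrite -AB; exact: fpset_neq0.
Qed.

Lemma post_selectN X (B : fpset (option X)) :
  (forall x, ~ (B : set _) (Some x)) -> post_select B = None.
Proof. by move=> BN; rewrite /post_select; case: pselect => // h; case: (h) => x Bx; case: (BN x). Qed.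

Definition postselection_sesquilaw : sesquilaw_data sets.
Proof.
refine (@SesquilawData sets maybe_monad powerset_monad
  (fun X => @maybe_set_incl X) (fun X => @post_select X) _ _).
- move=> X Y f; apply: funext => -[A|]; apply: fpset_ext => /=.
  + by rewrite !image_comp.
  + by rewrite image_set1.
- move=> X Y f; apply: funext => B /=.
  rewrite [in RHS]/post_select; case: pselect => [h|h] /=.
  + apply: post_selectP; apply/seteqP; split => y /=.
    * by move=> [x Bx <-]; exists (Some x).
    * by move=> [[x|] Bx //= [<-]]; exists x.
  + by apply: post_selectN => y /= [[x|] Bx //= _]; apply: h; exists x.
Defined.

Section Distributions.
Context {R : realType}.

(* A formal sum \sum_i l_i |x_i> is represented by its weight function.  Here
   {classic X} is X with a choice structure, as finite sums require. *)
Record dist (X : Type) := Dist {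
  weight :> X -> R;
  weight_ge0 : forall x, 0 <= weight x;
  weight_finite : finite_set [set x | weight x != 0];
  weight_sum1 : \sum_(x \in [set: {classic X}]) weight x = 1 }.

Lemma dist_ext X (p q : dist X) : (forall x, p x = q x) -> p = q.
Proof.
case: p => p p0 pf p1; case: q => q q0 qf q1 /= /funext pq; subst q.
by rewrite (Prop_irrelevance p0 q0) (Prop_irrelevance pf qf)
  (Prop_irrelevance p1 q1).
Qed.

Definition expect X (p g : X -> R) : R :=
  \sum_(x \in [set: {classic X}]) (p x * g x).

Lemma expect_fset X (p g : X -> R) (A : {fset {classic X}}) :
  (forall x : X, p x != 0 -> (x : {classic X}) \in A) ->
  expect p g = \sum_(x <- A) p x * g x.
Proof.
move=> pA; apply: fsbigTE => x; apply: contraNeq => px; apply: pA.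
by apply: contraNneq px => ->; rewrite mul0r.
Qed.

Lemma finsuppP X (p : X -> R) : finite_set [set x | p x != 0] ->
  exists A : {fset {classic X}},
    forall x : X, p x != 0 -> (x : {classic X}) \in A.
Proof.
move=> fp; have [A pA] := (@finite_fsetP {classic X} _).1 fp; exists A => x px.
by have : [set` A] (x : {classic X}) by rewrite -pA.
Qed.

Definition dirac_weight X (x y : X) : R := if `[< x = y >] then 1 else 0.

Lemma dirac_weight_neq0 X (x y : X) : dirac_weight x y != 0 -> x = y.
Proof. by rewrite /dirac_weight; case: asboolP; rewrite ?eqxx. Qed.

Lemma dirac_expect X (x : X) g : expect (dirac_weight x) g = g x.
Proof.
rewrite (@expect_fset _ _ _ [fset (x : {classic X})]%fset); last first.
  by move=> y h; rewrite -(dirac_weight_neq0 h) in_fset1.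
by rewrite big_seq_fset1 /dirac_weight asboolT// mul1r.
Qed.

Lemma expect1 X (p : X -> R) :
  expect p (fun=> 1) = \sum_(x \in [set: {classic X}]) p x.
Proof. by apply: eq_fsbigr => x _; rewrite mulr1. Qed.

Lemma dirac_finite X (x : X) : finite_set [set y | dirac_weight x y != 0].
Proof.
apply: sub_finite_set (finite_set1 x) => y /=.
by exact: (fun h => esym (dirac_weight_neq0 h)).
Qed.

Program Definition dirac X (x : X) : dist X := @Dist X (dirac_weight x) _ _ _.
Next Obligation. by move=> X x y; rewrite /dirac_weight; case: asbool. Qed.
Next Obligation. by move=> X x; exact: dirac_finite. Qed.
Next Obligation. by move=> X x; rewrite -expect1 dirac_expect. Qed.

Lemma expect_at X (p : X -> R) x :
  expect p (fun y => dirac_weight y x) = p x.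
Proof.
rewrite -[RHS](dirac_expect x) /expect; apply: eq_fsbigr => y _.
rewrite mulrC /dirac_weight; case: asboolP => [->|yx].
  by rewrite asboolT.
by rewrite asboolF// => /esym.
Qed.

Lemma dist_expect X (p q : dist X) :
  (forall g, expect p g = expect q g) -> p = q.
Proof. by move=> pq; apply: dist_ext => x; rewrite -expect_at pq expect_at. Qed.

Definition bind_weight X Y (p : X -> R) (k : X -> Y -> R) (y : Y) : R :=
  expect p (fun x => k x y).

Section Bind.
Context {X Y : Type} (p : dist X) (k : X -> dist Y).

Lemma bind_finsupp : exists (A : {fset {classic X}}) (B : {fset {classic Y}}),
  [/\ forall x : X, p x != 0 -> (x : {classic X}) \in A,
      forall (x : {classic X}) (y : Y), x \in A -> k x y != 0 ->
        (y : {classic Y}) \in B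
    & forall y : Y, bind_weight p k y != 0 -> (y : {classic Y}) \in B].
Proof.
have [A pA] := finsuppP (weight_finite p).
have /choice[C kC] x := finsuppP (weight_finite (k x)).
pose B := (\bigcup_(x <- A) C x)%fset.
have kB (x : {classic X}) (y : Y) : x \in A -> k x y != 0 ->
    (y : {classic Y}) \in B.
  by move=> xA kxy; apply/bigfcupP; exists x; rewrite ?xA//; exact: kC.
exists A, B; split => // y; apply: contraNT => yB.
rewrite /bind_weight (expect_fset _ pA) big_seq big1// => x xA.
have [->|kxy] := eqVneq (k x y) 0; first by rewrite mulr0.
by rewrite (kB _ _ xA kxy) in yB.
Qed.

Lemma bind_expect g :
  expect (bind_weight p k) g = expect p (fun x => expect (k x) g).
Proof.
have [A [B [pA kB bB]]] := bind_finsupp.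
rewrite (expect_fset _ bB) (expect_fset _ pA).
under eq_bigr => y _ do rewrite /bind_weight (expect_fset _ pA) mulr_suml.
rewrite exchange_big /= big_seq [RHS]big_seq; apply: eq_bigr => x xA.
rewrite (@expect_fset _ _ _ B) => [|y]; last exact: kB.
by rewrite mulr_sumr; apply: eq_bigr => y _; rewrite mulrA.
Qed.

Lemma bind_ge0 y : 0 <= bind_weight p k y.
Proof. by apply: fsumr_ge0 => x _; rewrite mulr_ge0// weight_ge0. Qed.

Lemma bind_finite : finite_set [set y | bind_weight p k y != 0].
Proof.
have [_ [B [_ _ bB]]] := bind_finsupp.
by apply: (@finite_subfset {classic Y} B) => y /= /bB.
Qed.

Lemma bind_sum1 : \sum_(y \in [set: {classic Y}]) bind_weight p k y = 1.
Proof.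
rewrite -expect1 bind_expect -[RHS](weight_sum1 p).
by apply: eq_fsbigr => x _ /=; rewrite expect1 weight_sum1 mulr1.
Qed.
End Bind.

Definition map_weight X Y (f : X -> Y) (p : X -> R) (y : Y) : R :=
  \sum_(x \in (f @^-1` [set y] : set {classic X})) p x.

Lemma map_weightE X Y (f : X -> Y) (p : X -> R) :
  map_weight f p = bind_weight p (fun x => dirac (f x)).
Proof.
apply: funext => y; rewrite /map_weight fsbig_mkcond; apply: eq_fsbigr => x _.
rewrite /patch /= /dirac_weight; case: asboolP => [fxy|fxy].
  by rewrite mem_set// mulr1.
by rewrite memNset// mulr0.
Qed.

Program Definition dist_map X Y (f : X -> Y) (p : dist X) : dist Y :=
  @Dist Y (map_weight f p) _ _ _.
Next Obligation. by move=> X Y f p y; rewrite map_weightE; exact: bind_ge0. Qed.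
Next Obligation. by move=> X Y f p; rewrite map_weightE; exact: bind_finite. Qed.
Next Obligation. by move=> X Y f p; rewrite map_weightE; exact: bind_sum1. Qed.

Program Definition dist_mult X (P : dist (dist X)) : dist X :=
  @Dist X (fun x => \sum_(p \in [set: {classic (dist X)}]) (P p * p x)) _ _ _.
Next Obligation. by move=> X P x; exact: (bind_ge0 P id). Qed.
Next Obligation. by move=> X P; exact: (bind_finite P id). Qed.
Next Obligation. by move=> X P; exact: (bind_sum1 P id). Qed.

Lemma map_expect X Y (f : X -> Y) (p : dist X) g :
  expect (dist_map f p) g = expect p (fun x => g (f x)).
Proof.
rewrite /= map_weightE bind_expect; apply: eq_fsbigr => x _.
by rewrite dirac_expect.
Qed.

Lemma mult_expect X (P : dist (dist X)) g :
  expect (dist_mult P) g = expect P (fun p => expect p g).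
Proof. exact: (bind_expect P id). Qed.

Program Definition supp X (p : dist X) : fpset X :=
  @FPset X [set x | p x != 0] (weight_finite p) _.
Next Obligation.
move=> X p; apply: contrapT => /forallNP p0; have := weight_sum1 p.
rewrite fsbig1 => [/esym/eqP|x _]; first by rewrite oner_eq0.
by apply: contrapT => px; apply: (p0 x); apply/eqP.
Qed.
End Distributions.
Arguments dist : clear implicits.

Definition distribution_functor (R : realType) : functor sets sets.
Proof.
refine (@Functor sets sets (dist R) (fun X Y (f : X -> Y) => dist_map f) _ _).
- by move=> X; apply: funext => p; apply: dist_expect => g; rewrite map_expect.
- move=> X Y Z h f; apply: funext => p; apply: dist_expect => g.
  by rewrite [RHS](map_expect h (dist_map f p)) !map_expect.
Defined.

Definition distribution_monad (R : realType) : monad sets.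
Proof.
refine (@Monad sets (distribution_functor R) (fun X => @dirac R X)
  (fun X => @dist_mult R X) _ _ _ _ _).
- move=> X Y f; apply: funext => x; apply: dist_expect => g.
  by rewrite map_expect !dirac_expect.
- move=> X Y f; apply: funext => P; apply: dist_expect => g.
  rewrite mult_expect !map_expect mult_expect.
  by congr expect; apply: funext => p; rewrite map_expect.
- move=> X; apply: funext => p; apply: dist_expect => g.
  by rewrite mult_expect dirac_expect.
- move=> X; apply: funext => p; apply: dist_expect => g.
  rewrite mult_expect map_expect.
  by congr expect; apply: funext => x; rewrite dirac_expect.
- move=> X; apply: funext => P; apply: dist_expect => g.
  rewrite !mult_expect map_expect.
  by congr expect; apply: funext => Q; rewrite mult_expect.
Defined.

Section Normalization.
Context {R : realType} {X : Type}.

(* p : dist R (option X) is the subdistribution \sum_x p (Some x) |x>, and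
   None carries the missing mass. *)
Definition mass (p : dist R (option X)) : R :=
  \sum_(x \in [set: {classic X}]) p (Some x).

Lemma expect_Some (p : option X -> R) (g : X -> R) :
  \sum_(x \in [set: {classic X}]) (p (Some x) * g x) = expect p (oapp g 0).
Proof.
rewrite /expect -(@fsbig_image _ _ _ {classic X} {classic (option X)} setT Some
  (fun o => p o * oapp g 0 o)); last by move=> x y _ _ [].
apply: fsbig_widen => // -[x|] [_ h] /=; last by rewrite mulr0.
by case: h; exists x.
Qed.

Lemma massE (p : dist R (option X)) : mass p = expect p (oapp (fun=> 1) 0).
Proof. by rewrite -expect_Some; apply: eq_fsbigr => x _; rewrite mulr1. Qed.

Lemma mass_ge0 (p : dist R (option X)) : 0 <= mass p.
Proof. by apply: fsumr_ge0 => x _; exact: weight_ge0. Qed.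

Program Definition normalized (p : dist R (option X)) (h : mass p != 0)
  : dist R X := @Dist R X (fun x => p (Some x) / mass p) _ _ _.
Next Obligation. by move=> p _ x; rewrite divr_ge0 ?weight_ge0 ?mass_ge0. Qed.
Next Obligation.
move=> p _; have fp : finite_set (Some @^-1` [set o | p o != 0]).
  by apply: finite_preimage; [move=> x y _ _ [] | exact: weight_finite].
apply: sub_finite_set fp => x /=; apply: contraNneq => ->.
by rewrite mul0r.
Qed.
Next Obligation. by move=> p h; rewrite -mulr_fsuml divff. Qed.

Definition normalize (p : dist R (option X)) : option (dist R X) :=
  match pselect (mass p != 0) with
  | left h => Some (normalized h)
  | right _ => None
  end.

Definition maybe_dist_incl (p : option (dist R X)) : dist R (option X) :=
  if p is Some q then dist_map Some q else dirac None.

Lemma normalized_expect (p : dist R (option X)) (h : mass p != 0) g :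
  expect (normalized h) g = expect p (oapp g 0) / mass p.
Proof.
rewrite -expect_Some mulr_fsuml; apply: eq_fsbigr => x _ /=.
by rewrite mulrAC.
Qed.
End Normalization.

Definition normalization_sesquilaw (R : realType) : sesquilaw_data sets.
Proof.
refine (@SesquilawData sets maybe_monad (distribution_monad R)
  (fun X => @maybe_dist_incl R X) (fun X => @normalize R X) _ _).
- move=> X Y f; apply: funext => -[p|]; apply: dist_expect => g.
  + by rewrite [LHS](map_expect Some (dist_map f p))
      [RHS](map_expect (omap f) (dist_map Some p)) !map_expect.
  + by rewrite [RHS](map_expect (omap f) (dirac None)) !dirac_expect.
- move=> X Y f; apply: funext => p /=.
  have mE : mass (dist_map (omap f) p) = mass p.
    by rewrite !massE map_expect; congr expect; apply: funext => -[].
  rewrite /normalize; case: pselect => h1; case: pselect => h2 /=.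
  + congr Some; apply: dist_expect => g.
    rewrite map_expect !normalized_expect mE map_expect; congr (_ / _).
    by congr expect; apply: funext => -[].
  + by case: h2; rewrite -mE.
  + by case: h1; rewrite mE.
  + by [].
Defined.

(* Main.v *)
From mathcomp Require Import all_boot all_order all_algebra finmap.
From mathcomp Require Import boolp classical_sets functions cardinality.
Require Import Defs.
From mathcomp Require Import reals.

(** Weights are nonnegative, so no cancellation can occur in the finite sums
that define the operations on distributions: a finite sum of nonnegative terms
is nonzero exactly when one of its terms is ([expect_neq0]).  Consequently
taking supports turns sums into existential quantifiers, that is, the
pushforward of a distribution into a direct image ([supp_map]) and the
multiplication of the distribution monad into a union ([supp_mult]).  As the
support of a point mass is a singleton ([supp_dirac]), support is a morphism of
monads.

The same principle shows that a subdistribution has nonzero total mass if and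
only if its support contains an element other than the failure point
([mass_neq0]).  So normalization and post-selection fail on corresponding
inputs; and when they succeed, dividing by the nonzero total mass leaves the
support unchanged ([supp_normalize]).  Compatibility with the inclusions
([supp_maybe_dist_incl]) is again about images and singletons. *)

Set Implicit Arguments.
Unset Strict Implicit.
Unset Printing Implicit Defensive.

Import Order.TTheory GRing.Theory Num.Theory.

Local Open Scope classical_set_scope.
Local Open Scope ring_scope.

Section Support.
Context {R : realType}.

(** Nonnegative terms cannot cancel.  Pushforwards, mixtures and total masses are
all expectations of nonnegative functions, which is how this determines their
supports. *)
Lemma expect_neq0 X (p g : X -> R) :
  (forall x, 0 <= p x) -> finite_set [set x | p x != 0] ->
  (forall x, 0 <= g x) ->
  expect p g != 0 <-> exists x, p x != 0 /\ g x != 0.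
Proof.
move=> p0 fp g0; have [A pA] := finsuppP fp.
rewrite (expect_fset _ pA) psumr_neq0; last by move=> x _; rewrite mulr_ge0.
split=> [/hasP[x _ /=]|[x [px gx]]].
  by rewrite lt0r mulf_eq0 negb_or => /andP[/andP[px gx] _]; exists x.
apply/hasP; exists x; first exact: pA.
by rewrite /= lt0r mulf_neq0//= mulr_ge0.
Qed.

Lemma dirac_neq0 X (x y : X) : dirac x y != 0 :> R <-> y = x.
Proof.
split=> [yx|->]; first exact/esym/(dirac_weight_neq0 yx).
by rewrite /= /dirac_weight asboolT// oner_eq0.
Qed.

Lemma supp_dirac X (x : X) : supp (@dirac R X x) = fpset1 x.
Proof.
by apply: fpset_ext; apply/seteqP; split=> y /dirac_neq0.
Qed.

Lemma supp_map X Y (f : X -> Y) (p : dist R X) :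
  supp (dist_map f p) = fpset_map f (supp p).
Proof.
(* A pushforward is a mixture of the point masses at the points f x. *)
have neq0 y : dist_map f p y != 0 <-> exists x, p x != 0 /\ f x = y.
  rewrite /= map_weightE expect_neq0; last 3 first.
  - exact: weight_ge0.
  - exact: weight_finite.
  - by move=> x; exact: weight_ge0.
  split=> -[x [px]]; first by move=> /dirac_neq0 ->; exists x.
  by move=> <-; exists x; split=> //; apply/dirac_neq0.
apply: fpset_ext; apply/seteqP; split=> y /=.
  by move=> /neq0[x [px <-]]; exists x.
by move=> [x px <-]; apply/neq0; exists x.
Qed.

Lemma supp_mult X (P : dist R (dist R X)) :
  supp (dist_mult P) = fpset_join (fpset_map (@supp R X) (supp P)).
Proof.
have neq0 x : dist_mult P x != 0 <-> exists p, P p != 0 /\ p x != 0.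
  apply: expect_neq0; [exact: weight_ge0 | exact: weight_finite |].
  by move=> p; exact: weight_ge0.
apply: fpset_ext; apply/seteqP; split=> x /=.
  by move=> /neq0[p [Pp px]]; exists (supp p) => //; exists p.
by move=> [_ [p Pp <-] px]; apply/neq0; exists p.
Qed.

Lemma mass_neq0 X (p : dist R (option X)) :
  mass p != 0 <-> exists x, p (Some x) != 0.
Proof.
rewrite massE expect_neq0; last 3 first.
- exact: weight_ge0.
- exact: weight_finite.
- by case=> [x|] /=; rewrite ?ler01.
split=> [[[x|] [px]]|[x px]] /=; last by exists (Some x); rewrite oner_eq0.
  by exists x.
by rewrite eqxx.
Qed.

Lemma supp_maybe_dist_incl X (p : option (dist R X)) :
  supp (maybe_dist_incl p) = maybe_set_incl (omap (@supp R X) p).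
Proof. by case: p => [p|]; [exact: supp_map | exact: supp_dirac]. Qed.

Lemma supp_normalize X (p : dist R (option X)) :
  omap (@supp R X) (normalize p) = post_select (supp p).
Proof.
rewrite /normalize; case: pselect => [p0|p0] /=; apply/esym.
  (* Division by the nonzero mass does not change which weights vanish. *)
  apply: post_selectP; apply/seteqP; split=> x /=.
    by rewrite mulf_eq0 negb_or => /andP[].
  by move=> px; rewrite mulf_neq0// invr_eq0.
by apply: post_selectN => x px; apply/p0/mass_neq0; exists x.
Qed.

End Support.

Lemma id_monad_morphism (A : category) (T : monad A) :
  is_monad_morphism (S := T) (T := T) (F := id_functor A) (fun X => idm (T X)).
Proof.
split=> [X Y f|X|X] /=; last by rewrite comp_idl.
  by rewrite comp_idl comp_idr.
by rewrite fmap_id !comp_idr comp_idl.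
Qed.

Lemma supp_monad_morphism (R : realType) :
  is_monad_morphism (S := distribution_monad R) (T := powerset_monad)
    (F := id_functor sets) (fun X : sets => @supp R X).
Proof.
split=> [X Y f|X|X]; apply: funext => p.
- exact: supp_map.
- exact: supp_mult.
- exact: supp_dirac.
Qed.

Theorem proposition3p17 (R : realType) :
  is_sesquilaw_morphism
    (L1 := normalization_sesquilaw R) (L2 := postselection_sesquilaw)
    (F := id_functor sets)
    (fun X : sets => idm (maybe_monad X))
    (fun X : sets => @supp R X).
Proof.
split.
- exact: id_monad_morphism.
- exact: supp_monad_morphism.
- move=> X; rewrite fmap_id; apply: funext => p.
  exact: supp_maybe_dist_incl.
- move=> X; rewrite fmap_id; apply: funext => p.
  exact: supp_normalize.
Qed.
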